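(* Let $H_1,H_2,K_1,K_2$ be Hilbert spaces, and let $T_{1}:D(T_{1})\subset H_{1}\to K_{1}$ and $T_{2}:D(T_{2})\subset H_{2}\to K_{2}$ be two closed operators with closed ranges. Then $T=T_{1}\bigoplus T_{2}:D(T_{1})\bigoplus D(T_{2})\subset H_{1}\bigoplus H_{2}\to K_{1}\bigoplus K_{2}$ has a Moore-Penrose inverse, and moreover $$T^{\dagger}=(T_{1}\bigoplus T_{2})^{\dagger}=T_{1}^{\dagger}\bigoplus T_{2}^{\dagger}.$$
   Context: Operators are linear, defined on a linear subspace (the domain, not assumed dense), and closed means the graph is closed. $N(T)$, $R(T)$ are null space and range, and $C(T)=D(T)\cap N(T)^{\perp}$. The Moore-Penrose inverse is defined for every closed operator $T:D(T)\subset H\to K$ (for which $D(T)=N(T)\oplus^{\perp}C(T)$, an orthogonal direct sum): it is the linear operator $T^{\dagger}:D(T^{\dagger})=R(T)\oplus^{\perp}R(T)^{\perp}\subset K\to H$ with $T^{\dagger}y=(T|_{C(T)})^{-1}y$ for $y\in R(T)$ and $T^{\dagger}y=0$ for $y\in R(T)^{\perp}$. $H\bigoplus K$ denotes the Hilbert space of pairs $(h,k)$ with inner product $\langle(h_1,k_1),(h_2,k_2)\rangle=\langle h_1,h_2\rangle+\langle k_1,k_2\rangle$. The direct sum of operators is $(T_{1}\bigoplus T_{2})(h_{1},h_{2})=(T_{1}h_{1},T_{2}h_{2})$ for $h_1\in D(T_1)$, $h_2\in D(T_2)$. *)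

(* Defs.v *)
From HB Require Import structures.
From mathcomp Require Import all_boot all_order all_algebra.
From mathcomp Require Import sesquilinear complex ring.
From mathcomp Require Import boolp classical_sets reals topology normedtype.

Set Implicit Arguments.
Unset Strict Implicit.
Unset Printing Implicit Defensive.

Import Order.TTheory GRing.Theory Num.Theory.
Import numFieldNormedType.Exports.

Local Open Scope classical_set_scope.
Local Open Scope ring_scope.

(* The scalar field is R or R[i]; everything below is uniform in the choice. *)
Variant scalar_kind := RealScalars | ComplexScalars.

Definition scalar (R : realType) (k : scalar_kind) : numFieldType :=
  match k with RealScalars => R | ComplexScalars => R[i] end.

Section ScalarTheory.
Variables (R : realType) (k : scalar_kind).

Definition sconj : scalar R k -> scalar R k :=
  match k with RealScalars => idfun | ComplexScalars => @Num.conj R[i] end.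

Definition ssqrt : scalar R k -> scalar R k :=
  match k with
  | RealScalars => @Num.sqrt R
  | ComplexScalars => fun z : R[i] => sqrtC z
  end.

Lemma sconj_zmod_morphism : zmod_morphism sconj.
Proof. by rewrite /sconj; case: k => //= x y; rewrite rmorphB. Qed.

Lemma sconj_monoid_morphism : monoid_morphism sconj.
Proof.
rewrite /sconj; case: k; split => //=; first exact: rmorph1.
by move=> x y; rewrite rmorphM.
Qed.

HB.instance Definition _ :=
  GRing.isZmodMorphism.Build _ _ sconj sconj_zmod_morphism.
HB.instance Definition _ :=
  GRing.isMonoidMorphism.Build _ _ sconj sconj_monoid_morphism.

Lemma ssqrt_ge0 x : 0 <= x -> 0 <= ssqrt x.
Proof.
rewrite /ssqrt; case: k x => x x0 /=; first exact: sqrtr_ge0.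
by rewrite sqrtC_ge0.
Qed.

Lemma sqr_ssqrt x : 0 <= x -> ssqrt x ^+ 2 = x.
Proof.
by rewrite /ssqrt; case: k x => x x0 /=; [exact: sqr_sqrtr | rewrite sqrtCK].
Qed.

End ScalarTheory.

(* A {dot H for sconj} form is linear in its first argument and conjugate-linear
   in its second. *)
HB.mixin Record NormedModule_isInner (R : realType) (k : scalar_kind) H
    & CompleteNormedModule (scalar R k) H := {
  inner_subdef : {dot H for @sconj R k};
  norm_inner_subdef : forall x : H, `|x| ^+ 2 = inner_subdef x x
}.

#[short(type="hilbertType")]
HB.structure Definition Hilbert (R : realType) (k : scalar_kind) :=
  {H of CompleteNormedModule (scalar R k) H & NormedModule_isInner R k H}.

Definition inner (R : realType) (k : scalar_kind) (H : hilbertType R k) :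
  {dot H for @sconj R k} := inner_subdef.

Lemma norm_inner (R : realType) (k : scalar_kind) (H : hilbertType R k)
  (x : H) : `|x| ^+ 2 = inner H x x.
Proof. exact: norm_inner_subdef. Qed.

(* A type of its own: the library's norm on H1 * H2 is the maximum norm. *)
Definition hsum (H1 H2 : Type) : Type := (H1 * H2)%type.

Section HilbertSum.
Variables (R : realType) (k : scalar_kind) (H1 H2 : hilbertType R k).
Local Notation K := (scalar R k).

HB.instance Definition _ := GRing.Lmodule.copy (hsum H1 H2) (H1 * H2)%type.

Definition hsum_norm (p : hsum H1 H2) : K :=
  ssqrt (`|p.1| ^+ 2 + `|p.2| ^+ 2).

Lemma hsum_norm_ge0 p : 0 <= hsum_norm p.
Proof. by apply: ssqrt_ge0; rewrite addr_ge0 ?exprn_ge0. Qed.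

Lemma sqr_hsum_norm p : hsum_norm p ^+ 2 = `|p.1| ^+ 2 + `|p.2| ^+ 2.
Proof. by apply: sqr_ssqrt; rewrite addr_ge0 ?exprn_ge0. Qed.

Lemma hsum_norm_eq p (c : K) :
  0 <= c -> c ^+ 2 = `|p.1| ^+ 2 + `|p.2| ^+ 2 -> hsum_norm p = c.
Proof.
move=> c0 cE; apply/eqP; rewrite -(@eqrXn2 _ 2) ?hsum_norm_ge0 //.
by rewrite sqr_hsum_norm cE.
Qed.

Lemma hsum_normD p q : hsum_norm (p + q) <= hsum_norm p + hsum_norm q.
Proof.
rewrite -(@ler_pXn2r _ 2) ?nnegrE ?addr_ge0 ?hsum_norm_ge0 //.
rewrite sqr_hsum_norm sqrrD !sqr_hsum_norm.
set a := `|p.1|; set b := `|q.1|; set c := `|p.2|; set d := `|q.2|.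
have [a0 b0 c0 d0] : [/\ 0 <= a, 0 <= b, 0 <= c & 0 <= d] by split; exact: normr_ge0.
have s0 := mulr_ge0 (hsum_norm_ge0 p) (hsum_norm_ge0 q).
have cs : a * b + c * d <= hsum_norm p * hsum_norm q.
  rewrite -(@ler_pXn2r _ 2) ?nnegrE ?addr_ge0 ?(mulr_ge0, hsum_norm_ge0) //.
  rewrite exprMn !sqr_hsum_norm -/a -/b -/c -/d -subr_ge0.
  have -> : (a ^+ 2 + c ^+ 2) * (b ^+ 2 + d ^+ 2) - (a * b + c * d) ^+ 2 =
            (a * d - c * b) ^+ 2.
    by ring.
  by rewrite real_exprn_even_ge0 // realB // ger0_real // mulr_ge0.
rewrite -/a -/b -/c -/d.
have bound (x y z : K) : 0 <= x -> 0 <= y -> 0 <= z -> x <= y + z ->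
    x ^+ 2 <= y ^+ 2 + y * z *+ 2 + z ^+ 2.
  move=> x0 y0 z0 xyz; rewrite -sqrrD.
  by rewrite ler_pXn2r ?nnegrE ?addr_ge0.
apply: le_trans (_ : (a ^+ 2 + a * b *+ 2 + b ^+ 2) +
                     (c ^+ 2 + c * d *+ 2 + d ^+ 2) <= _).
  by apply: lerD; apply: bound; rewrite ?normr_ge0 //; exact: ler_normD.
rewrite (_ : _ + _ = a ^+ 2 + c ^+ 2 + (a * b + c * d) *+ 2 + (b ^+ 2 + d ^+ 2)).
  by rewrite lerD2r lerD2l lerMn2r cs orbT.
by ring.
Qed.

Lemma hsum_normZ (a : K) p : hsum_norm (a *: p) = `|a| * hsum_norm p.
Proof.
apply: hsum_norm_eq; first by rewrite mulr_ge0 ?hsum_norm_ge0.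
by rewrite exprMn sqr_hsum_norm /= !normrZ !exprMn mulrDr.
Qed.

Lemma hsum_norm0_eq0 p : hsum_norm p = 0 -> p = 0.
Proof.
move=> p0; have := sqr_hsum_norm p; rewrite p0 expr0n /= => /esym/eqP.
rewrite paddr_eq0 ?exprn_ge0 // !sqrf_eq0 !normr_eq0 => /andP[/eqP p1 /eqP p2].
by case: p p1 p2 {p0} => /= x y -> ->.
Qed.

HB.instance Definition _ := Lmodule_isNormed.Build K (hsum H1 H2)
  hsum_normD hsum_normZ hsum_norm0_eq0.

Lemma sqr_norm_hsum (p : hsum H1 H2) : `|p| ^+ 2 = `|p.1| ^+ 2 + `|p.2| ^+ 2.
Proof. exact: sqr_hsum_norm. Qed.

Lemma norm_hsum_fst (p : hsum H1 H2) : `|p.1| <= `|p|.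
Proof.
by rewrite -(@ler_pXn2r _ 2) ?nnegrE // sqr_norm_hsum lerDl exprn_ge0.
Qed.

Lemma norm_hsum_snd (p : hsum H1 H2) : `|p.2| <= `|p|.
Proof.
by rewrite -(@ler_pXn2r _ 2) ?nnegrE // sqr_norm_hsum lerDr exprn_ge0.
Qed.

Lemma norm_hsum_le (p : hsum H1 H2) : `|p| <= `|p.1| + `|p.2|.
Proof.
rewrite -(@ler_pXn2r _ 2) ?nnegrE ?addr_ge0 // sqr_norm_hsum sqrrD.
by rewrite addrAC lerDl mulrn_wge0 // mulr_ge0.
Qed.

Lemma hsum_complete (F : set_system (hsum H1 H2)) :
  ProperFilter F -> cauchy F -> cvg F.
Proof.
move=> FF /cauchyP Fc.
have ballE (V : normedModType K) (x y : V) (e : K) :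
  ball x e y = (`|x - y| < e) by rewrite -ball_normE.
have c1 : cvg ((fst : hsum H1 H2 -> H1) @ F).
  apply: cauchy_cvg; apply/cauchyP => e e0; have [p Fp] := Fc e e0.
  exists p.1; apply: (@filterS _ F _ _ _ _ Fp) => q /=; rewrite !ballE.
  by apply: le_lt_trans; exact: (norm_hsum_fst (p - q)).
have c2 : cvg ((snd : hsum H1 H2 -> H2) @ F).
  apply: cauchy_cvg; apply/cauchyP => e e0; have [p Fp] := Fc e e0.
  exists p.2; apply: (@filterS _ F _ _ _ _ Fp) => q /=; rewrite !ballE.
  by apply: le_lt_trans; exact: (norm_hsum_snd (p - q)).
apply/cvg_ex; move: c1 c2 => /cvg_ex[x Fx] /cvg_ex[y Fy].
exists ((x, y) : hsum H1 H2); apply/cvgrPdist_lt => e e0.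
have e20 : 0 < e / 2 by rewrite divr_gt0.
move/cvgrPdist_lt : Fx => /(_ _ e20) Fx; move/cvgrPdist_lt : Fy => /(_ _ e20) Fy.
near=> q; apply: (le_lt_trans (norm_hsum_le _)); rewrite [e]splitr.
by apply: ltrD; near: q.
Unshelve. all: by end_near. Qed.

HB.instance Definition _ := Uniform_isComplete.Build (hsum H1 H2) hsum_complete.

Definition hsum_inner (p q : hsum H1 H2) : K :=
  inner H1 p.1 q.1 + inner H2 p.2 q.2.

Lemma hsum_inner_bilinear :
  bilinear_for (GRing.Scale.Law.clone _ _ *%R _)
    (GRing.Scale.Law.clone _ _ (@sconj R k \; *%R) _) hsum_inner.
Proof.
split=> p a q r; rewrite /hsum_inner /=.
  by rewrite !linearPl /= mulrDr addrACA.
by rewrite !linearPr /= mulrDr addrACA.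
Qed.

HB.instance Definition _ := bilinear_isBilinear.Build K _ _ _ _ _ hsum_inner
  hsum_inner_bilinear.

Lemma hsum_inner_hermitian p q :
  hsum_inner p q = (-1) ^+ false * @sconj R k (hsum_inner q p).
Proof.
rewrite /hsum_inner expr0 mul1r raddfD /=.
by congr (_ + _); rewrite hermC expr0 mul1r.
Qed.

HB.instance Definition _ := isHermitianSesquilinear.Build _ _ _ _ hsum_inner
  hsum_inner_hermitian.

Lemma norm_hsum_inner (p : hsum H1 H2) : `|p| ^+ 2 = hsum_inner p p.
Proof. by rewrite sqr_norm_hsum !norm_inner. Qed.

Lemma hsum_inner_gt0 p : p != 0 -> 0 < hsum_inner p p.
Proof. by move=> p0; rewrite -norm_hsum_inner exprn_gt0 // normr_gt0. Qed.

HB.instance Definition _ := isDotProduct.Build _ _ hsum_inner hsum_inner_gt0.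

HB.instance Definition _ := NormedModule_isInner.Build R k (hsum H1 H2)
  norm_hsum_inner.

End HilbertSum.

Section Operators.
Variables (R : realType) (k : scalar_kind).

(* The values of [app] outside [dom] are junk, ignored by [op_eq] and by every
   notion below. *)
Record operator (H K : hilbertType R k) := Operator {
  dom : set H;
  app :> H -> K;
  dom0 : dom 0;
  dom_linear : forall (a : scalar R k) x y, dom x -> dom y -> dom (a *: x + y);
  app_linear : forall (a : scalar R k) x y, dom x -> dom y ->
    app (a *: x + y) = a *: app x + app y
}.

Definition op_eq (H K : hilbertType R k) (S T : operator H K) :=
  dom S = dom T /\ forall x, dom T x -> S x = T x.

Definition graph (H K : hilbertType R k) (T : operator H K) : set (hsum H K) :=
  [set p | dom T p.1 /\ p.2 = T p.1].

Definition closed_operator (H K : hilbertType R k) (T : operator H K) :=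
  closed (graph T).

Definition null_space (H K : hilbertType R k) (T : operator H K) : set H :=
  [set x | dom T x /\ T x = 0].

Definition range_space (H K : hilbertType R k) (T : operator H K) : set K :=
  T @` dom T.

Definition ortho_compl (H : hilbertType R k) (A : set H) : set H :=
  [set x | forall a, A a -> inner H x a = 0].

Definition carrier (H K : hilbertType R k) (T : operator H K) : set H :=
  dom T `&` ortho_compl (null_space T).

(* [S y] for [y] in the range is the preimage of [y] under the restriction of
   [T] to [carrier T], on which [T] is injective. *)
Definition is_mpinv (H K : hilbertType R k) (T : operator H K)
    (S : operator K H) :=
  [/\ dom S = [set y + z | y in range_space T
                         & z in ortho_compl (range_space T)],
      forall y, range_space T y -> carrier T (S y) /\ T (S y) = y
    & forall y, ortho_compl (range_space T) y -> S y = 0].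

Lemma zero_dom_linear (H : hilbertType R k) (a : scalar R k) (x y : H) :
  setT x -> setT y -> setT (a *: x + y).
Proof. by []. Qed.

Lemma zero_app_linear (H K : hilbertType R k) (a : scalar R k) (x y : H) :
  setT x -> setT y -> (0 : K) = a *: 0 + 0.
Proof. by rewrite scaler0 addr0. Qed.

Definition zero_operator (H K : hilbertType R k) : operator H K :=
  @Operator H K setT (fun=> 0) I (@zero_dom_linear H) (@zero_app_linear H K).

HB.instance Definition _ (H K : hilbertType R k) :=
  gen_eqMixin (operator H K).
HB.instance Definition _ (H K : hilbertType R k) :=
  gen_choiceMixin (operator H K).

(* The operator characterized by [is_mpinv T]: unique up to [op_eq], and
   existing when [T] is closed. If there is none, the value is a dummy. *)
Definition mpinv (H K : hilbertType R k) (T : operator H K) : operator K H :=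
  xget (zero_operator K H) [set S | is_mpinv T S].

Lemma carrier_inj (H K : hilbertType R k) (T : operator H K) (x y : H) :
  carrier T x -> carrier T y -> T x = T y -> x = y.
Proof.
move=> [Dx Cx] [Dy Cy] Txy; pose d := (-1) *: y + x.
have Nd : null_space T d.
  split; first exact: dom_linear.
  by rewrite app_linear // Txy scaleN1r addNr.
have /eqP : inner H d d = 0 by rewrite {1}/d linearPl /= Cx // Cy // mulr0 addr0.
rewrite -norm_inner sqrf_eq0 normr_eq0 /d scaleN1r addrC subr_eq0.
by move/eqP.
Qed.

Lemma is_mpinv_unique (H K : hilbertType R k) (T : operator H K)
  (S1 S2 : operator K H) : is_mpinv T S1 -> is_mpinv T S2 -> op_eq S1 S2.
Proof.
move=> [D1 r1 o1] [D2 r2 o2]; split=> [|x]; first by rewrite D1 D2.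
rewrite D2 => -[y Ry [z Oz <-]].
have O0 : ortho_compl (range_space T) 0 by move=> a _; rewrite linear0l.
have R0 : range_space T 0.
  exists 0; first exact: dom0.
  have := app_linear 1 (dom0 T) (dom0 T); rewrite !scale1r addr0.
  by rewrite -[LHS]addr0 => /addrI.
have step S : is_mpinv T S -> S (y + z) = S y.
  move=> [D r o].
  have Sy : dom S y by rewrite D; exists y => //; exists 0; rewrite ?addr0.
  have Sz : dom S z by rewrite D; exists 0 => //; exists z; rewrite ?add0r.
  by have := app_linear 1 Sy Sz; rewrite !scale1r (o z Oz) addr0.
rewrite !step //; have [C1 E1] := r1 y Ry; have [C2 E2] := r2 y Ry.
by apply: (carrier_inj C1 C2); rewrite E1.
Qed.

Section DirectSum.
Variables (H1 H2 K1 K2 : hilbertType R k).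
Variables (T1 : operator H1 K1) (T2 : operator H2 K2).

Definition osum_dom : set (hsum H1 H2) := [set h | dom T1 h.1 /\ dom T2 h.2].

Definition osum_app (h : hsum H1 H2) : hsum K1 K2 := (T1 h.1, T2 h.2).

Lemma osum_dom0 : osum_dom 0.
Proof. by split; exact: dom0. Qed.

Lemma osum_dom_linear (a : scalar R k) (g h : hsum H1 H2) :
  osum_dom g -> osum_dom h -> osum_dom (a *: g + h).
Proof. by move=> [g1 g2] [h1 h2]; split; exact: dom_linear. Qed.

Lemma osum_app_linear (a : scalar R k) (g h : hsum H1 H2) :
  osum_dom g -> osum_dom h ->
  osum_app (a *: g + h) = a *: osum_app g + osum_app h.
Proof.
by move=> [g1 g2] [h1 h2]; rewrite /osum_app /= !app_linear.
Qed.

Definition osum : operator (hsum H1 H2) (hsum K1 K2) :=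
  Operator osum_dom0 osum_dom_linear osum_app_linear.

End DirectSum.

End Operators.

(* Main.v *)
(** For a closed operator [T], the null space is closed, so the projection theorem splits [D(T)] as
    [N(T)] plus [C(T)]; hence every value of [T] is attained on [C(T)], and the Moore-Penrose
    inverse can be built by choosing, for [y] in [R(T) + R(T)^perp], the element [x] of [C(T)] with
    [y - T x] orthogonal to [R(T)].  Null space, range and orthogonal complement of a direct sum
    are the products of those of the summands, so the direct sum of two Moore-Penrose inverses is
    one, and uniqueness concludes. *)
Require Import Defs.
From mathcomp Require Import all_boot all_order all_algebra.
From mathcomp Require Import sesquilinear complex ring.
From mathcomp Require Import boolp classical_sets reals topology normedtype.

Set Implicit Arguments.
Unset Strict Implicit.
Unset Printing Implicit Defensive.

Import Order.TTheory GRing.Theory Num.Theory.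
Import numFieldNormedType.Exports.
Import Defs. (* [scalar] is also a notation of [GRing.Theory] *)

Local Open Scope classical_set_scope.
Local Open Scope ring_scope.

(** * Infima of scalars and closedness in terms of distance *)

(** Complex scalars are only partially ordered, but nonnegative ones are real, so the infimum is
    taken in [R] and embedded back. It serves for the squared distance to a subspace, which is a
    value in [scalar R k]. *)
Lemma scalar_nneg_inf (R : realType) (k : scalar_kind) (A : set (scalar R k)) :
  A !=set0 -> (forall x, A x -> 0 <= x) ->
  exists d, (forall x, A x -> d <= x) /\
            (forall e, 0 < e -> exists2 x, A x & x < d + e).
Proof.
case: k A => /= A [a Aa] A0.
  have hA : has_inf A by split; [exists a | exists 0].
  exists (inf A); split=> [x Ax|e e0]; first exact: ge_inf (hA.2) _ Ax.
  by have [x Ax xe] := inf_adherent e0 hA; exists x.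
pose B : set R := [set r | A (r%:C)%C].
have ReK (z : R[i]) : 0 <= z -> ((complex.Re z)%:C)%C = z.
  by move=> z0; rewrite RRe_real // ger0_real.
have hB : has_inf B.
  split; first by exists (complex.Re a); rewrite /B /= ReK // A0.
  by exists 0 => r /A0; rewrite lecR.
exists ((inf B)%:C)%C; split=> [x Ax|e e0].
  rewrite -(ReK x (A0 _ Ax)) lecR; apply: ge_inf (hB.2) _ _.
  by rewrite /B /= ReK // A0.
have eE := ReK e (ltW e0).
have Re0 : 0 < complex.Re e by rewrite -ltcR eE.
have [r Br re] := inf_adherent Re0 hB.
by exists (r%:C)%C => //; rewrite -eE -rmorphD /= ltcR.
Qed.

Lemma closed_distP (K : numFieldType) (V : normedModType K) (A : set V) :
  closed A <->
  forall x, (forall e : K, 0 < e -> exists2 a, A a & `|x - a| < e) -> A x.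
Proof.
split=> cA x.
  move=> xA; apply: cA => B /nbhs_ballP[e /= e0 xB].
  have [a Aa ax] := xA e e0.
  by exists a; split=> //; apply: xB; rewrite -ball_normE.
move=> xA; apply: cA => e e0.
have [a [Aa]] := xA _ (nbhsx_ballx x e e0).
by rewrite -ball_normE => ax; exists a.
Qed.

(* Stated over an abstract field because [field] diverges on [scalar R k]. *)
Lemma proj_coef_identity (F : fieldType) (p q n m : F) : n != 0 ->
  p * q * n^-1 ^+ 2 * n + - (p / n) * q + - (q / n) * p + m = m - p * q / n.
Proof. by move=> n0; field. Qed.

(** * The projection theorem *)

Section Projection.
Variables (R : realType) (k : scalar_kind) (H : hilbertType R k).
Implicit Types u v x a : H.

Lemma sqr_norm_scalar (z : scalar R k) : `|z| ^+ 2 = z * sconj z.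
Proof.
by rewrite /sconj; case: k z => z /=; [rewrite real_normK ?num_real | rewrite normCK].
Qed.

Lemma sconj_sqr_norm x : sconj (`|x| ^+ 2) = `|x| ^+ 2.
Proof. by rewrite norm_inner [RHS]hermC expr0 mul1r. Qed.

Lemma sqr_normDZ u v (t : scalar R k) : `|t *: v + u| ^+ 2 =
  `|t| ^+ 2 * `|v| ^+ 2 + t * sconj (inner H u v) + sconj t * inner H u v
  + `|u| ^+ 2.
Proof.
rewrite !norm_inner linearPl /= !linearPr /= sqr_norm_scalar.
rewrite (hermC (inner H) v u) expr0 mul1r; ring.
Qed.

Lemma parallelogram u v :
  `|u + v| ^+ 2 + `|u - v| ^+ 2 = 2 * (`|u| ^+ 2 + `|v| ^+ 2).
Proof.
have := sqr_normDZ u v 1; have := sqr_normDZ u v (-1).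
rewrite scale1r scaleN1r ![_ + u]addrC => -> ->.
rewrite normrN normr1 rmorphN rmorph1; ring.
Qed.

(** Pythagoras for the projection of [u] on the line through [a]; for [a = 0] both sides are
    [|u| ^+ 2]. *)
Lemma sqr_norm_sub_proj u a :
  `|u - (inner H u a / `|a| ^+ 2) *: a| ^+ 2 =
  `|u| ^+ 2 - `|inner H u a| ^+ 2 / `|a| ^+ 2.
Proof.
have [->|a0] := eqVneq a 0.
  by rewrite scaler0 linear0r normr0 !expr0n /= mul0r !subr0.
have n0 : `|a| ^+ 2 != 0 by rewrite sqrf_eq0 normr_eq0.
rewrite addrC -scaleNr sqr_normDZ normrN normrM normfV normrX normr_id.
rewrite rmorphN rmorphM fmorphV /= sconj_sqr_norm exprMn sqr_norm_scalar.
exact: proj_coef_identity.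
Qed.

Lemma cauchy_schwarz u a : `|inner H u a| <= `|u| * `|a|.
Proof.
have [->|a0] := eqVneq a 0; first by rewrite linear0r !normr0 mulr0.
have n0 : 0 < `|a| ^+ 2 by rewrite exprn_gt0 // normr_gt0.
rewrite -(@ler_pXn2r _ 2) ?nnegrE ?mulr_ge0 // exprMn -ler_pdivrMr //.
by rewrite -subr_ge0 -sqr_norm_sub_proj exprn_ge0.
Qed.

(** The points of [M] almost nearest to [x] form a Cauchy filter; its limit [m] lies in [M] by
    closedness, and [x - m] is orthogonal to [M] because nearly nearest points are nearly
    orthogonal. *)
Lemma projection (M : set H) : closed M -> M 0 ->
  (forall (b : scalar R k) x y, M x -> M y -> M (b *: x + y)) ->
  forall x, exists2 m, M m & ortho_compl M (x - m).
Proof.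
move=> cM M0 Mlin x.
have MZ b y : M y -> M (b *: y) by move=> My; rewrite -[_ *: _]addr0; exact: Mlin.
have MD y z : M y -> M z -> M (y + z).
  by move=> My Mz; rewrite -[y]scale1r; exact: Mlin.
have [|_ [m _ <-]|d [dle dlt]] :=
  @scalar_nneg_inf R k ((fun m => `|x - m| ^+ 2) @` M).
- by exists (`|x - 0| ^+ 2), 0.
- exact: exprn_ge0.
have dM m : M m -> d <= `|x - m| ^+ 2 by move=> Mm; apply: dle; exists m.
pose B (e : scalar R k) : set H := [set m | M m /\ `|x - m| ^+ 2 < d + e].
pose F := filter_from [set e : scalar R k | 0 < e] B.
have FF : ProperFilter F.
  apply: filter_from_proper => [|e e0].
    apply: filter_from_filter; first by exists 1 => /=.
    move=> e f /= e0 f0.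
    (* A positive scalar below both [e] and [f], obtained without a minimum since the order may be
       partial. *)
    have ef0 : 0 < e * f / (e + f) by rewrite divr_gt0 ?mulr_gt0 ?addr_gt0.
    have s0 : 0 < e + f by rewrite addr_gt0.
    exists (e * f / (e + f)) => // m [Mm mB]; split; split=> //;
      apply: (lt_le_trans mB); rewrite lerD2l ler_pdivrMr // mulrDr.
      by rewrite lerDr mulr_ge0 // ltW.
    by rewrite [f * e]mulrC lerDl mulr_ge0 // ltW.
  by have [_ [m Mm <-] me] := dlt e e0; exists m.
(* By the parallelogram law, as the midpoint of [p] and [q] lies in [M]. *)
have near_min (p q : H) e : 0 < e -> B e p -> B e q -> `|p - q| ^+ 2 < 4 * e.
  move=> e0 [Mp pe] [Mq qe].
  have pq : d <= `|x - 2^-1 *: (p + q)| ^+ 2 by apply/dM/MZ/MD.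
  have E : (x - q) + (x - p) = 2%:R *: (x - 2^-1 *: (p + q)).
    rewrite scalerBr scalerA divff ?pnatr_eq0 // scale1r scaler_nat mulr2n.
    by rewrite addrACA -opprD [q + p]addrC.
  have E' : (x - q) - (x - p) = p - q by rewrite opprB addrC addrA subrK.
  have := parallelogram (x - q) (x - p); rewrite E E' => PL.
  have -> : `|p - q| ^+ 2 = 2 * (`|x - q| ^+ 2 + `|x - p| ^+ 2)
     - 4 * `|x - 2^-1 *: (p + q)| ^+ 2.
    rewrite -PL normrZ exprMn normr_nat; ring.
  have -> : 4 * e = 2 * ((d + e) + (d + e)) - 4 * d by ring.
  by apply: ltr_leB; [rewrite ltr_pM2l // ltrD | rewrite ler_pM2l].
have cF : cvg F.
  apply: cauchy_cvg; apply/cauchyP => e e0.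
  (* Chosen so that the bound of [near_min] becomes [4 * (e / 2) ^+ 2 = e ^+ 2]. *)
  have f0 : 0 < (e / 2) ^+ 2 by rewrite exprn_gt0 // divr_gt0.
  have [_ [p Mp <-] pe] := dlt _ f0.
  exists p; exists ((e / 2) ^+ 2) => // q Bq; rewrite -ball_normE /=.
  rewrite -(@ltr_pXn2r _ 2) ?nnegrE ?(ltW e0) //.
  have -> : e ^+ 2 = 4 * (e / 2) ^+ 2.
    by rewrite exprMn exprVn mulrCA -natrX mulfV ?mulr1 // pnatr_eq0.
  exact: near_min.
move/cvg_ex: cF => [m Fm].
have approx e f : 0 < e -> 0 < f -> exists2 q, B f q & `|m - q| < e.
  move=> e0 f0; have Fe : F (ball m e) by apply: Fm; exact: nbhsx_ballx.
  have Ff : F (B f) by exists f.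
  have [q [Bq]] := filter_ex (filterI Ff Fe).
  by rewrite -ball_normE => mq; exists q.
have Mm : M m.
  move/closed_distP: cM; apply=> e e0.
  by have [q [Mq _] mq] := approx e 1 e0 ltr01; exists q.
exists m => // a Ma; apply/eqP; rewrite -normr_eq0; apply: contraT => t0.
have a0 : a != 0.
  by apply: contraNneq t0 => ->; rewrite linear0r normr0.
have na : 0 < `|a| by rewrite normr_gt0.
have tp : 0 < `|inner H (x - m) a| by rewrite lt_def t0 normr_ge0.
(* With [q] near [m], split [x - m] as [(x - q) + (q - m)]. This [e] makes each part contribute less
   than [t / 2] to the inner product with [a], whence [t < t]. *)
set t := `|_| in t0 tp; pose e := t / 2 / `|a|.
have e0 : 0 < e by rewrite !divr_gt0.
have [q [Mq xq] mq] := approx e (e ^+ 2) e0 (exprn_gt0 2 e0).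
have ea : e * `|a| = t / 2 by rewrite /e divfK // gt_eqF.
(* Moving [q] along [a] stays in [M], so the distance cannot drop below [d]; by Pythagoras the
   possible gain is at most [|x - q| ^+ 2 - d < e ^+ 2]. *)
have h1 : `|inner H (x - q) a| < t / 2.
  rewrite -(@ltr_pXn2r _ 2) ?nnegrE ?normr_ge0 ?divr_ge0 ?(ltW tp) //.
  rewrite -ea exprMn -ltr_pdivrMr ?exprn_gt0 //.
  have : d <= `|x - q - (inner H (x - q) a / `|a| ^+ 2) *: a| ^+ 2.
    by rewrite -addrA -opprD; apply/dM/MD => //; exact: MZ.
  rewrite sqr_norm_sub_proj lerBrDr => h.
  by have := le_lt_trans h xq; rewrite ltrD2l.
have h2 : `|inner H (q - m) a| < t / 2.
  apply: (le_lt_trans (cauchy_schwarz _ _)).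
  by rewrite -ea distrC ltr_pM2r.
suff: t < t by rewrite ltxx.
rewrite {1}/t (_ : x - m = 1 *: (x - q) + (q - m)); last first.
  by rewrite scale1r addrA subrK.
rewrite linearPl /= mul1r; apply: (le_lt_trans (ler_normD _ _)).
by rewrite [ltRHS]splitr ltrD.
Qed.

End Projection.

(** * Orthogonal complements *)

Section OrthoCompl.
Variables (R : realType) (k : scalar_kind) (H : hilbertType R k).

Lemma ortho_compl0 (A : set H) : ortho_compl A 0.
Proof. by move=> a _; rewrite linear0l. Qed.

Lemma ortho_compl_linear (A : set H) (a : scalar R k) (x y : H) :
  ortho_compl A x -> ortho_compl A y -> ortho_compl A (a *: x + y).
Proof. by move=> Ax Ay z Az; rewrite linearPl /= Ax // Ay // mulr0 addr0. Qed.

Lemma ortho_compl_self (A : set H) (x : H) : A x -> ortho_compl A x -> x = 0.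
Proof.
move=> Ax /(_ x Ax)/eqP.
by rewrite -norm_inner sqrf_eq0 normr_eq0 => /eqP.
Qed.

End OrthoCompl.

(** Testing against the pairs [(a, 0)] and [(0, a)], which belong to [A] because both factors
    contain 0, separates the two coordinates. *)
Lemma ortho_compl_hsum (R : realType) (k : scalar_kind)
  (H1 H2 : hilbertType R k) (A : set (hsum H1 H2)) (A1 : set H1)
  (A2 : set H2) :
  A1 0 -> A2 0 -> (forall h, A h <-> A1 h.1 /\ A2 h.2) ->
  forall h, ortho_compl A h <-> ortho_compl A1 h.1 /\ ortho_compl A2 h.2.
Proof.
move=> A10 A20 AE h; split=> [Oh|[O1 O2] a /AE[Aa1 Aa2]].
  split=> a Aa.
    have := Oh (a, 0) ((AE (a, 0)).2 (conj Aa A20)).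
    by rewrite /inner /= /hsum_inner /= linear0r addr0.
  have := Oh (0, a) ((AE (0, a)).2 (conj A10 Aa)).
  by rewrite /inner /= /hsum_inner /= linear0r add0r.
by transitivity (hsum_inner h a) => //; rewrite /hsum_inner O1 // O2 // addr0.
Qed.

(** * Existence of the Moore-Penrose inverse of a closed operator *)

Section Operators.
Variables (R : realType) (k : scalar_kind) (H K : hilbertType R k).
Variable T : operator H K.

Lemma app0 : T 0 = 0.
Proof.
have := app_linear (-1) (dom0 T) (dom0 T).
by rewrite !scaleN1r !addNr.
Qed.

Lemma range_space0 : range_space T 0.
Proof. by exists 0; [exact: dom0 | exact: app0]. Qed.

Lemma range_space_linear (a : scalar R k) (x y : K) :
  range_space T x -> range_space T y -> range_space T (a *: x + y).
Proof.
move=> [u Du <-] [v Dv <-].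
by exists (a *: u + v); [exact: dom_linear | exact: app_linear].
Qed.

Lemma null_space_linear (a : scalar R k) (x y : H) :
  null_space T x -> null_space T y -> null_space T (a *: x + y).
Proof.
move=> [Dx Tx] [Dy Ty]; split; first exact: dom_linear.
by rewrite app_linear // Tx Ty scaler0 addr0.
Qed.

Lemma carrier_linear (a : scalar R k) (x y : H) :
  carrier T x -> carrier T y -> carrier T (a *: x + y).
Proof.
move=> [Dx Cx] [Dy Cy].
by split; [exact: dom_linear | exact: ortho_compl_linear].
Qed.

(** The null space is the slice of the graph at second coordinate 0. *)
Lemma null_space_closed : closed_operator T -> closed (null_space T).
Proof.
move=> /closed_distP cT; apply/closed_distP => x xN.
suff : graph T ((x, 0) : hsum H K) by case=> /= Dx /esym.
apply: cT => e e0; have [a [Da Ta] xa] := xN e e0.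
exists ((a, 0) : hsum H K); first by split.
by apply: le_lt_trans (norm_hsum_le _) _; rewrite /= subrr normr0 addr0.
Qed.

(** Removing from a preimage its projection on the null space keeps its image and lands in the
    carrier. *)
Lemma range_space_carrier (y : K) : closed_operator T ->
  range_space T y -> exists2 x, carrier T x & T x = y.
Proof.
move=> /null_space_closed cN [x Dx <-].
have N0 : null_space T 0 by split; [exact: dom0 | exact: app0].
have [m [Dm Tm] xm] := projection cN N0 null_space_linear x.
exists ((-1) *: m + x).
  by split; [exact: dom_linear | rewrite scaleN1r addrC].
by rewrite app_linear // Tm scaler0 add0r.
Qed.

Lemma mpinv_exists : closed_operator T -> exists S, is_mpinv T S.
Proof.
move=> cT.
pose P (y : K) := [set x | carrier T x /\ ortho_compl (range_space T) (y - T x)].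
pose D : set K := [set y + z | y in range_space T
                             & z in ortho_compl (range_space T)].
(* The default 0 is taken only outside [D]. The relation [P] is linear in the pair [(y, x)] and
   determines [x], so linearity of [f] on [D] follows through [fE]. *)
pose f y := xget 0 (P y).
(* [T x - T x'] lies both in the range and in its orthogonal complement, hence vanishes. *)
have P_inj y x x' : P y x -> P y x' -> x = x'.
  move=> [Cx Ox] [Cx' Ox']; apply: (carrier_inj Cx Cx').
  apply/eqP; rewrite -subr_eq0; apply/eqP.
  apply: (@ortho_compl_self _ _ _ (range_space T)).
    rewrite addrC -scaleN1r; apply: range_space_linear.
      by exists x' => //; case: Cx'.
    by exists x => //; case: Cx.
  have -> : T x - T x' = (-1) *: (y - T x) + (y - T x').
    by rewrite scaleN1r opprB addrA subrK.
  exact: ortho_compl_linear.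
have Pf y : D y -> P y (f y).
  move=> [u Ru [v Ov <-]]; apply: xgetPex.
  have [x Cx Tx] := range_space_carrier cT Ru.
  by exists x; split=> //; rewrite Tx addrAC subrr add0r.
have fE y x : P y x -> f y = x.
  move=> Pyx; apply: (P_inj y) => //; apply: xgetPex.
  by exists x.
have D0 : D 0.
  exists 0; first exact: range_space0.
  by exists 0; [exact: ortho_compl0 | rewrite addr0].
have D_linear (a : scalar R k) x y : D x -> D y -> D (a *: x + y).
  move=> [u Ru [v Ov <-]] [u' Ru' [v' Ov' <-]].
  exists (a *: u + u'); first exact: range_space_linear.
  exists (a *: v + v'); first exact: ortho_compl_linear.
  by rewrite scalerDr addrACA.
have f_linear (a : scalar R k) x y : D x -> D y ->
    f (a *: x + y) = a *: f x + f y.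
  move=> /Pf[Cx Ox] /Pf[Cy Oy]; apply: fE; split; first exact: carrier_linear.
  rewrite app_linear; [|by case: Cx|by case: Cy].
  rewrite opprD addrACA -scalerBr; exact: ortho_compl_linear.
exists (Operator D0 D_linear f_linear); split=> //= y.
  move=> Ry; have [x Cx Tx] := range_space_carrier cT Ry.
  rewrite (fE y x) //; split=> //; rewrite Tx subrr; exact: ortho_compl0.
move=> Oy; apply: fE; split; last by rewrite app0 subr0.
by split; [exact: dom0 | exact: ortho_compl0].
Qed.

Lemma mpinvP : closed_operator T -> is_mpinv T (mpinv T).
Proof. by move=> /mpinv_exists; exact: xgetPex. Qed.

End Operators.

(** * Direct sums *)

Section DirectSum.
Variables (R : realType) (k : scalar_kind) (H1 H2 K1 K2 : hilbertType R k).
Variables (T1 : operator H1 K1) (T2 : operator H2 K2).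

(** Up to reordering the four coordinates, the graph of the sum is the product of the two graphs. A
    point of it within [e / 2] gives, in each factor, a graph point within [e], as both coordinate
    differences are below [e / 2]. *)
Lemma closed_osum :
  closed_operator T1 -> closed_operator T2 -> closed_operator (osum T1 T2).
Proof.
move=> /closed_distP c1 /closed_distP c2; apply/closed_distP => -[[h1 h2] [k1 k2]] hP.
suff [[/= D1 E1] [/= D2 E2]] : graph T1 ((h1, k1) : hsum H1 K1) /\
    graph T2 ((h2, k2) : hsum H2 K2).
  by split; [split | rewrite /= E1 E2].
have half (e x y z : scalar R k) : z < e / 2 -> x <= z -> y <= z -> x + y < e.
  move=> ze xz yz; rewrite [e]splitr.
  by apply: ltrD; [exact: le_lt_trans xz _ | exact: le_lt_trans yz _].
split; [apply: c1 | apply: c2] => e e0;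
  have [[g l] [/= [Dg1 Dg2] ->] gl] := hP _ (divr_gt0 e0 (ltr0n _ 2));
  have hg := norm_hsum_fst (((h1, h2), (k1, k2)) - (g, osum_app T1 T2 g)
    : hsum (hsum H1 H2) (hsum K1 K2));
  have kl := norm_hsum_snd (((h1, h2), (k1, k2)) - (g, osum_app T1 T2 g)
    : hsum (hsum H1 H2) (hsum K1 K2)).
- exists ((g.1, T1 g.1) : hsum H1 K1); first by split.
  apply: le_lt_trans (norm_hsum_le _) _; apply: (half _ _ _ _ gl).
    exact: le_trans (norm_hsum_fst _) hg.
  exact: le_trans (norm_hsum_fst _) kl.
- exists ((g.2, T2 g.2) : hsum H2 K2); first by split.
  apply: le_lt_trans (norm_hsum_le _) _; apply: (half _ _ _ _ gl).
    exact: le_trans (norm_hsum_snd _) hg.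
  exact: le_trans (norm_hsum_snd _) kl.
Qed.

Lemma range_osum (y : hsum K1 K2) : range_space (osum T1 T2) y <->
  range_space T1 y.1 /\ range_space T2 y.2.
Proof.
case: y => y1 y2; split=> [[h [D1 D2] [<- <-]]|[[h1 D1 /= <-] [h2 D2 /= <-]]].
  by split; [exists h.1 | exists h.2].
by exists (h1, h2).
Qed.

Lemma null_osum (h : hsum H1 H2) : null_space (osum T1 T2) h <->
  null_space T1 h.1 /\ null_space T2 h.2.
Proof.
split=> [[[D1 D2] [E1 E2]] //|[[D1 E1] [D2 E2]]].
by split=> //=; rewrite /osum_app E1 E2.
Qed.

Lemma ortho_range_osum (y : hsum K1 K2) :
  ortho_compl (range_space (osum T1 T2)) y <->
  ortho_compl (range_space T1) y.1 /\ ortho_compl (range_space T2) y.2.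
Proof.
by apply: ortho_compl_hsum range_osum y; exact: range_space0.
Qed.

Lemma carrier_osum (h : hsum H1 H2) : carrier (osum T1 T2) h <->
  carrier T1 h.1 /\ carrier T2 h.2.
Proof.
have N0 (H K : hilbertType R k) (T : operator H K) : null_space T 0.
  by split; [exact: dom0 | exact: app0].
have := ortho_compl_hsum (N0 _ _ T1) (N0 _ _ T2) null_osum h => OE.
by split=> [[[D1 D2] /OE[]]|[[D1 O1] [D2 O2]]] //; split=> //; apply/OE.
Qed.

Lemma is_mpinv_osum (S1 : operator K1 H1) (S2 : operator K2 H2) :
  is_mpinv T1 S1 -> is_mpinv T2 S2 -> is_mpinv (osum T1 T2) (osum S1 S2).
Proof.
move=> [D1 r1 o1] [D2 r2 o2]; split.
- rewrite /= /osum_dom D1 D2; apply/seteqP; split=> -[y1 y2] /=.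
    move=> [[u1 Ru1 [v1 Ov1 E1]] [u2 Ru2 [v2 Ov2 E2]]].
    exists ((u1, u2) : hsum K1 K2); first exact/range_osum.
    exists ((v1, v2) : hsum K1 K2); first exact/ortho_range_osum.
    by rewrite -E1 -E2.
  move=> [u /range_osum[Ru1 Ru2] [v /ortho_range_osum[Ov1 Ov2] [<- <-]]].
  by split; [exists u.1 => //; exists v.1 | exists u.2 => //; exists v.2].
- move=> [y1 y2] /range_osum[/r1[C1 E1] /r2[C2 E2]].
  by split; [exact/carrier_osum | rewrite /= /osum_app /= E1 E2].
- by move=> y /ortho_range_osum[/o1 E1 /o2 E2]; rewrite /= /osum_app E1 E2.
Qed.

End DirectSum.

Theorem theorem3p1 (R : realType) (k : scalar_kind)
  (H1 H2 K1 K2 : hilbertType R k)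
  (T1 : operator H1 K1) (T2 : operator H2 K2)
  (T1_closed : closed_operator T1) (T2_closed : closed_operator T2)
  (T1_range : closed (range_space T1)) (T2_range : closed (range_space T2)) :
  [/\ closed_operator (osum T1 T2),
      is_mpinv (osum T1 T2) (mpinv (osum T1 T2))
    & op_eq (mpinv (osum T1 T2)) (osum (mpinv T1) (mpinv T2))].
Proof.
(* Closedness of the sum ensures that its [mpinv] is a genuine Moore-Penrose inverse and not the
   dummy value, so that uniqueness applies to it. *)
have cT := closed_osum T1_closed T2_closed.
have TP := mpinvP cT.
split=> //; apply: (is_mpinv_unique TP).
by apply: is_mpinv_osum; exact: mpinvP.
Qed.
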